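(* Let $\mathcal{A}=\mathcal{A}_0+\mathsf{Y}\mathcal{A}_1+\cdots+\mathsf{Y}^d\mathcal{A}_d$ be a matrix polynomial with coefficients $\mathcal{A}_k\in\mathcal{C}^{n\times n}$, and let $a_k\in\mathbb{C}^{n\times n}$, $A_k\in\mathbb{R}_{\min}^{n\times n}$, $k=0,\dots,d$, be such that $(\mathcal{A}_{\epsilon,k})_{ij}\simeq(a_k)_{ij}\epsilon^{(A_k)_{ij}}$ for all $1\le i,j\le n$ and $0\le k\le d$. Denote by $A=A_0\oplus\mathsf{Y}A_1\oplus\cdots\oplus\mathsf{Y}^dA_d$ the associated min-plus matrix polynomial. Assume also that $\mathcal{A}_d=I$, the identity matrix in $\mathcal{C}^{n\times n}$, so that $A_d=I$, the identity matrix in $\mathbb{R}_{\min}^{n\times n}$. Then $A$ has $nd$ min-plus algebraic eigenvalues (belonging to $\mathbb{R}_{\min}$). Let $\Gamma=(\gamma_1\le\cdots\le\gamma_{nd})$ be the sequence of these eigenvalues. Assume that the eigenvalues $\mathcal{L}^1_\epsilon,\dots,\mathcal{L}^{nd}_\epsilon$ of $\mathcal{A}_\epsilon$ (counted with multiplicities) have first order asymptotics, $\mathcal{L}^i_\epsilon\sim\lambda_i\epsilon^{\Lambda_i}$, and let $\Lambda=(\Lambda_1\le\cdots\le\Lambda_{nd})$. Then $\Lambda\prec^{\rm w}\Gamma$.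
   Context: $\mathcal{C}$ is the ring of germs at $0^+$ of continuous functions $f:(0,\epsilon_0)\to\mathbb{C}$ (some $\epsilon_0>0$) such that $|f(\epsilon)|\le\epsilon^{-k}$ on $(0,\epsilon_0)$ for some constant $k>0$ (functions coinciding near $0$ are identified). For $f\in\mathcal{C}$, $a\in\mathbb{C}$, $A\in\mathbb{R}\cup\{+\infty\}$: $f(\epsilon)\simeq a\epsilon^A$ means $\lim_{\epsilon\to0^+}\epsilon^{-A}f(\epsilon)=a$ if $A\in\mathbb{R}$, and $f=0$ (near $0$) if $A=+\infty$. One says that $f\in\mathcal{C}$ has first order asymptotics, $f\sim a\epsilon^A$, if $f\simeq a\epsilon^A$ and either $A\in\mathbb{R}$, $a\ne0$, or $A=+\infty$. $\mathcal{A}_{\epsilon,k}$ and $\mathcal{A}_\epsilon$ are the values at $\epsilon$ of $\mathcal{A}_k$ and $\mathcal{A}$. The eigenvalues of $\mathcal{A}_\epsilon$ are the roots of the polynomial $\det(\mathcal{A}_\epsilon)$ in $\mathsf{Y}$. $\mathbb{R}_{\min}=\mathbb{R}\cup\{+\infty\}$ is the min-plus semifield, with addition $a\oplus b=\min(a,b)$, multiplication $ab=a+b$ (usual sum), zero element $+\infty$, unit element $0$. The min-plus identity matrix has diagonal entries $0$ and off-diagonal entries $+\infty$. A formal polynomial $P=\bigoplus_{k=0}^N P_k\mathsf{Y}^k$ of degree $N$ over $\mathbb{R}_{\min}$ (so $P_N\ne+\infty$) has associated polynomial function $\widehat P(y)=\min_k(P_k+ky)$ (the term $k=0$ being $P_0$),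 which factors uniquely as $\widehat P(y)=P_N+\sum_{i=1}^N\min(y,c_i)$ with $c_1\le\cdots\le c_N$ in $\mathbb{R}_{\min}$; the $c_i$ are the roots of $P$. The min-plus characteristic polynomial of the min-plus matrix polynomial $A$ is $P_A=\operatorname{per}A$, the min-plus permanent of the matrix with entries $A_{ij}=\bigoplus_k(A_k)_{ij}\mathsf{Y}^k\in\mathbb{R}_{\min}[\mathsf{Y}]$; that is, $(P_A)_\ell=\min\sum_{i=1}^n(A_{k_i})_{i\sigma(i)}$, the minimum being over permutations $\sigma$ of $\{1,\dots,n\}$ and $k_1,\dots,k_n\in\{0,\dots,d\}$ with $k_1+\cdots+k_n=\ell$. The min-plus algebraic eigenvalues of $A$ are the roots of $P_A$. For $u,v\in\mathbb{R}_{\min}^N$ with increasingly ordered entries $u_{(1)}\le\cdots\le u_{(N)}$ and $v_{(1)}\le\cdots\le v_{(N)}$, $u\prec^{\rm w}v$ ($u$ is weakly (super) majorized by $v$) means $u_{(1)}+\cdots+u_{(k)}\ge v_{(1)}+\cdots+v_{(k)}$ for all $k=1,\dots,N$ (usual sums in $\mathbb{R}\cup\{+\infty\}$). *)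

(* Defs.v *)
From HB Require Import structures.
From mathcomp Require Import all_boot all_order all_algebra all_fingroup.
From mathcomp Require Import complex.
From mathcomp Require Import all_classical all_reals all_analysis.

Set Implicit Arguments.
Unset Strict Implicit.
Unset Printing Implicit Defensive.

Import Order.TTheory GRing.Theory Num.Theory.
Import numFieldNormedType.Exports.

Local Open Scope ring_scope.
Local Open Scope complex_scope.
Local Open Scope classical_set_scope.

(* The min-plus semifield R \cup {+oo}.  It is given the usual order and, in
   ring_scope, the min-plus operations: x + y is the minimum, x * y is the usual
   sum, 0 is +oo and 1 is the real number 0.  The coercion to \bar R gives access
   to the usual operations. *)
Record minplus (R : realType) := MinPlus {
  mpval :> \bar R;
  mpvalP : mpval != -oo%E }.

Section MinPlusSemiring.
Variable R : realType.

HB.instance Definition _ := [isSub for @mpval R].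
HB.instance Definition _ := [Choice of minplus R by <:].
HB.instance Definition _ := [SubChoice_isSubOrder of minplus R by <: with ring_display].

Implicit Types x y z : minplus R.

Fact mp_min_subproof x y : Order.min (x : \bar R) y != -oo%E.
Proof. by rewrite minEle; case: ifP => _; apply: mpvalP. Qed.

Fact mp_sum_subproof x y : ((x : \bar R) + y)%E != -oo%E.
Proof. by rewrite adde_eq_ninfty negb_or !mpvalP. Qed.

Definition mp_infty : minplus R := MinPlus (isT : +oo%E != -oo%E :> \bar R).
Definition mp_zero : minplus R := MinPlus (isT : 0%:E != -oo%E :> \bar R).
Definition mp_min x y : minplus R := MinPlus (mp_min_subproof x y).
Definition mp_sum x y : minplus R := MinPlus (mp_sum_subproof x y).

Fact mp_minA : associative mp_min.
Proof. by move=> x y z; apply: val_inj; rewrite /= minA. Qed.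

Fact mp_minC : commutative mp_min.
Proof. by move=> x y; apply: val_inj; rewrite /= minC. Qed.

Fact mp_min_inftyl : left_id mp_infty mp_min.
Proof. by move=> x; apply: val_inj => /=; apply: min_r; rewrite leey. Qed.

Fact mp_sumA : associative mp_sum.
Proof. by move=> x y z; apply: val_inj; rewrite /= addeA. Qed.

Fact mp_sumC : commutative mp_sum.
Proof. by move=> x y; apply: val_inj; rewrite /= addeC. Qed.

Fact mp_sum_zerol : left_id mp_zero mp_sum.
Proof. by move=> x; apply: val_inj; rewrite /= add0e. Qed.

Fact mp_sum_minDl : left_distributive mp_sum mp_min.
Proof.
move=> x y z; apply: val_inj => /=.
case: (leP (x : \bar R) y) => [xy|/ltW yx].
  by rewrite min_l // leeD2r.
by rewrite min_r // leeD2r.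
Qed.

Fact mp_sum_inftyl : left_zero mp_infty mp_sum.
Proof. by move=> x; apply: val_inj; rewrite /= addye // mpvalP. Qed.

Fact mp_zero_neq_infty : mp_zero != mp_infty.
Proof. by []. Qed.

HB.instance Definition _ :=
  GRing.isNmodule.Build (minplus R) mp_minA mp_minC mp_min_inftyl.
HB.instance Definition _ :=
  GRing.Nmodule_isComNzSemiRing.Build (minplus R)
    mp_sumA mp_sumC mp_sum_zerol mp_sum_minDl mp_sum_inftyl mp_zero_neq_infty.

End MinPlusSemiring.

Definition permanent (S : comNzSemiRingType) (n : nat) (M : 'M[S]_n) : S :=
  \sum_(s : 'S_n) \prod_i M i (s i).

Definition matpoly (S : comNzSemiRingType) (n d : nat) (A : 'I_d.+1 -> 'M[S]_n) :
    'M[{poly S}]_n :=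
  \sum_(k < d.+1) 'X^k *: map_mx polyC (A k).

(* In min-plus notation P.[y] is min_k (P_k + k y), and the last condition reads
   P.[y] = P_N + \sum_i min (y, c_i) with the usual operations. *)
Definition minplus_roots (R : realType) (P : {poly minplus R})
    (c : seq (minplus R)) : Prop :=
  [/\ P != 0, size c = (size P).-1, sorted <=%O c &
      forall y : minplus R, P.[y] = lead_coef P * \prod_(ci <- c) (y + ci)].

Definition minplus_eigenvalues (R : realType) (n d : nat)
    (A : 'I_d.+1 -> 'M[minplus R]_n) (c : seq (minplus R)) : Prop :=
  minplus_roots (permanent (matpoly A)) c.

Definition weakly_majorized (R : realType) (N : nat)
    (u v : N.-tuple (minplus R)) : Prop :=
  forall k : nat, (1 <= k <= N)%N ->
    (\sum_(x <- take k (sort <=%O v)) (x : \bar R) <=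
     \sum_(x <- take k (sort <=%O u)) (x : \bar R))%E.

Definition roots_with_mult (F : fieldType) (p : {poly F}) (s : seq F) : Prop :=
  p != 0 /\ p = lead_coef p *: \prod_(z <- s) ('X - z%:P).

(* Germs at 0^+ are handled through representatives R -> R[i], whose values
   outside some interval ]0, e0[ are irrelevant.  The type (R[i])^o is R[i]
   with its usual topology. *)
Definition germC (R : realType) (f : R -> (R[i])^o) : Prop :=
  exists e0 k : R, [/\ 0 < e0, 0 < k &
    forall e : R, 0 < e < e0 ->
      {for e, continuous f} /\ `|f e| <= (e `^ (- k))%:C].

Definition simeq (R : realType) (f : R -> (R[i])^o) (a : R[i])
    (A : minplus R) : Prop :=
  match (A : \bar R) with
  | r%:E => (e `^ (- r))%:C * f e @[e --> 0^'+] --> (a : (R[i])^o)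
  | _ => \forall e \near 0^'+, f e = 0
  end.

Definition first_order (R : realType) (f : R -> (R[i])^o) (a : R[i])
    (A : minplus R) : Prop :=
  [/\ germC f, simeq f a A & (A : \bar R) = +oo%E \/ a <> 0].

(* Main.v *)
Require Import Defs.
From mathcomp Require Import all_boot all_order all_algebra.
From mathcomp Require Import fingroup perm complex zify.
From mathcomp Require Import all_classical all_reals all_analysis.
Import Order.TTheory GRing.Theory Num.Theory.
Import numFieldNormedType.Exports.
Local Open Scope ring_scope.
Local Open Scope complex_scope.
Local Open Scope classical_set_scope.

(* Evaluate the characteristic polynomial at [z e^r], with [r] real and [z] a
   nonzero complex number different from all the [lambda i].  Expanding the
   determinant bounds the value by a multiple of [e^p], where [p] is the value at
   [r] of the min-plus characteristic polynomial, i.e. the sum of the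
   [min (r, gamma_i)].  Factoring over the eigenvalues, no cancellation occurs by
   the choice of [z], so the value has exact order [e^q], where [q] is the sum of
   the [min (r, Lambda_i)].  Hence [p <= q] for every real [r], and these
   inequalities give the weak majorization.
   The existence of the min-plus roots is an induction on the degree, along the
   edges of the Newton polygon. *)

(** * Order and arithmetic of the min-plus semifield *)

Section MinPlusOrder.
Context {R : realType}.
Implicit Types x y z : minplus R.

Lemma mp_leE x y : (x <= y) = ((x : \bar R) <= y)%E.
Proof. by []. Qed.

(** The zero of the semifield is $+\infty$, hence the greatest element; the unit [1] is the real
    number 0. *)
Lemma mp_le0 x : x <= 0.
Proof. by rewrite mp_leE leey. Qed.

Lemma mp_addl x y : x <= y -> x + y = x.
Proof. by move=> xy; apply: val_inj; apply: min_l. Qed.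

Lemma mp_addr x y : y <= x -> x + y = y.
Proof. by rewrite addrC; apply: mp_addl. Qed.

Lemma mp_le_add z x y : (z <= x + y) = (z <= x) && (z <= y).
Proof. by rewrite mp_leE [X in (_ <= X)%E]/= le_min. Qed.

Lemma mp_add_lel x y : x + y <= x.
Proof. by have := lexx (x + y); rewrite mp_le_add => /andP[]. Qed.

Lemma mp_add_ler x y : x + y <= y.
Proof. by rewrite addrC mp_add_lel. Qed.

Lemma mp_le_sum (I : Type) (r : seq I) (P : pred I) (F : I -> minplus R) z :
  (forall i, P i -> z <= F i) -> z <= \sum_(i <- r | P i) F i.
Proof.
move=> zF; apply: (big_ind (fun x => z <= x)) => //; first exact: mp_le0.
by move=> x y zx zy; rewrite mp_le_add zx.
Qed.

Lemma mp_sum_le {n : nat} (F : 'I_n -> minplus R) i : \sum_j F j <= F i.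
Proof. by rewrite (bigD1 i) //= mp_add_lel. Qed.

Lemma mp_leM x y z t : x <= y -> z <= t -> x * z <= y * t.
Proof. by rewrite !mp_leE => xy zt; apply: leeD. Qed.

Lemma mp_leX x y m : x <= y -> x ^+ m <= y ^+ m.
Proof.
by move=> xy; elim: m => [|m IHm]; rewrite ?expr0 // !exprS mp_leM.
Qed.

Lemma mp_le_prod (I : Type) (r : seq I) (P : pred I) (F G : I -> minplus R) :
  (forall i, P i -> F i <= G i) ->
  \prod_(i <- r | P i) F i <= \prod_(i <- r | P i) G i.
Proof.
move=> FG; apply: (big_ind2 (fun x y => x <= y)) => // x y z t.
exact: mp_leM.
Qed.

Lemma mpval_prod (I : Type) (r : seq I) (P : pred I) (F : I -> minplus R) :
  mpval (\prod_(i <- r | P i) F i) = (\sum_(i <- r | P i) mpval (F i))%E.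
Proof. by apply: (big_morph (@mpval R)). Qed.

Lemma mp_fin r : r%:E != -oo%E :> \bar R. Proof. by []. Qed.

Definition mpfin r : minplus R := MinPlus (mp_fin r).

Lemma mpfinP x : x != 0 -> exists r, x = mpfin r.
Proof.
case: x => -[r||] p // x0; first by exists r; apply: val_inj.
Qed.

Lemma mpfin_neq0 r : mpfin r != 0. Proof. by []. Qed.

Lemma mpfinD r s : mpfin r * mpfin s = mpfin (r + s).
Proof. exact: val_inj. Qed.

Lemma mpfinX r m : mpfin r ^+ m = mpfin (r *+ m).
Proof. by elim: m => [|m IHm]; [apply: val_inj | rewrite exprS IHm mpfinD mulrS]. Qed.

Lemma mpfin_le r s : (mpfin r <= mpfin s) = (r <= s).
Proof. by rewrite mp_leE lee_fin. Qed.

Lemma mpfin_lt r s : (mpfin r < mpfin s) = (r < s).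
Proof. by rewrite !ltNge mpfin_le. Qed.

Lemma mp_leM2r z x y : z != 0 -> (x * z <= y * z) = (x <= y).
Proof. by case/mpfinP => r ->; rewrite !mp_leE /= leeD2rE. Qed.

Lemma mp_leM2l z x y : z != 0 -> (z * x <= z * y) = (x <= y).
Proof. by move=> z0; rewrite ![z * _]mulrC mp_leM2r. Qed.

Lemma mp_mul_eq0 x y : (x * y == 0) = (x == 0) || (y == 0).
Proof.
have [->|] := eqVneq x 0; first by rewrite mul0r eqxx.
have [->|] := eqVneq y 0; first by rewrite mulr0 eqxx.
by move=> /mpfinP[s ->] /mpfinP[r ->]; rewrite mpfinD (negPf (mpfin_neq0 _)).
Qed.

Lemma mp_expf_neq0 x m : x != 0 -> x ^+ m != 0.
Proof. by case/mpfinP => r ->; rewrite mpfinX. Qed.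

Lemma mp_prod_eq0 (I : eqType) (r : seq I) (F : I -> minplus R) :
  (\prod_(i <- r) F i == 0) = has (fun i => F i == 0) r.
Proof.
elim: r => [|i r IHr]; first by rewrite big_nil oner_eq0.
by rewrite big_cons mp_mul_eq0 IHr.
Qed.

End MinPlusOrder.

(** * Degree and leading coefficient of permanents and determinants *)

Section LeadingCoefficient.
Context {S : comNzSemiRingType}.
Implicit Types p q : {poly S}.

(** In the convolution of degree [m + k], an index above [m] kills the factor from [p], an index
    below [m] the factor from [q]. *)
Lemma size_coef_mul p q m k : (size p <= m.+1)%N -> (size q <= k.+1)%N ->
  (size (p * q)%R <= (m + k).+1)%N /\ (p * q)`_(m + k) = p`_m * q`_k.
Proof.
move=> sp sq; split.
  apply: leq_trans (size_polyMleq p q) _.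
  by move: sp sq; move: (size p) (size q) => a b; lia.
have mlt : (m < (m + k).+1)%N by rewrite ltnS leq_addr.
rewrite coefM (bigD1 (Ordinal mlt)) //= addKn big1 ?addr0 // => i.
rewrite -val_eqE /= => im.
have [lt_mi|le_im] := ltnP m i.
  by rewrite [p`_i]nth_default ?mul0r //; exact: leq_trans lt_mi.
have ltim : (i < m)%N by rewrite ltn_neqAle im.
rewrite [q`_(_)]nth_default ?mulr0 // (leq_trans sq) //.
by move: ltim; move: (nat_of_ord i) => a; lia.
Qed.

Lemma size_coef_prod (I : Type) (r : seq I) (F : I -> {poly S}) d :
  (forall i, size (F i) <= d.+1)%N ->
  (size (\prod_(i <- r) F i)%R <= (size r * d).+1)%N /\
  (\prod_(i <- r) F i)`_(size r * d) = \prod_(i <- r) (F i)`_d.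
Proof.
move=> sF; elim: r => [|i r [IHs IHc]].
  by rewrite !big_nil size_poly1 coef1.
have [sz cf] := size_coef_mul _ _ _ _ (sF i) IHs.
by rewrite !big_cons mulSn; split; rewrite // cf IHc.
Qed.

Lemma matpoly_coef n d (A : 'I_d.+1 -> 'M[S]_n) i j m :
  (matpoly A i j)`_m = \sum_(k < d.+1 | k == m :> nat) A k i j.
Proof.
rewrite /matpoly summxE coef_sum [RHS]big_mkcond; apply: eq_bigr => k _ /=.
by rewrite !mxE coefMC coefXn eq_sym; case: eqP; rewrite ?mul1r ?mul0r.
Qed.

Lemma size_matpoly n d (A : 'I_d.+1 -> 'M[S]_n) i j :
  (size (matpoly A i j) <= d.+1)%N.
Proof.
apply/leq_sizeP => m dm; rewrite matpoly_coef big_pred0 // => k.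
by apply/negbTE; rewrite neq_ltn (leq_trans (ltn_ord k) dm).
Qed.

Lemma horner_matpoly n d (A : 'I_d.+1 -> 'M[S]_n) x :
  map_mx (horner^~ x) (matpoly A) = \sum_(k < d.+1) x ^+ k *: A k.
Proof.
apply/matrixP => i j; rewrite !mxE /matpoly !summxE horner_sum.
by apply: eq_bigr => k _; rewrite !mxE hornerM_comm ?hornerXn ?hornerC //; exact: mulrC.
Qed.

Lemma horner_permanent n (M : 'M[{poly S}]_n) x :
  (permanent M).[x] = permanent (map_mx (horner^~ x) M).
Proof.
rewrite -horner_evalE /permanent rmorph_sum; apply: eq_bigr => s _.
by rewrite rmorph_prod; apply: eq_bigr => i _; rewrite mxE.
Qed.

(** In degree [n * d] only the identity permutation survives: any other one meets an off-diagonal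
    zero of [A ord_max]. The weights [w] cover the permanent (all equal to 1) and the determinant
    (signs) at once. *)
Lemma size_coef_expansion n d (A : 'I_d.+1 -> 'M[S]_n) (w : {perm 'I_n} -> S) :
  A ord_max = 1%:M -> w 1%g = 1 ->
  let P := \sum_(s : {perm 'I_n}) (w s)%:P * \prod_i matpoly A i (s i) in
  size P = (n * d).+1 /\ lead_coef P = 1.
Proof.
move=> A1 w1 P.
have sized (s : {perm 'I_n}) :
    (size (\prod_i matpoly A i (s i))%R <= (n * d).+1)%N /\
    (\prod_i matpoly A i (s i))`_(n * d) = \prod_i (matpoly A i (s i))`_d.
  have := size_coef_prod _ (index_enum 'I_n) (fun i => matpoly A i (s i)) d.
  have -> : size (index_enum 'I_n) = n by rewrite /index_enum -enumT size_enum_ord.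
  by apply => i; exact: size_matpoly.
have cf i j : (matpoly A i j)`_d = (i == j)%:R.
  by rewrite matpoly_coef (big_pred1 ord_max) ?A1 ?mxE // => k.
have P1 : P`_(n * d) = 1.
  rewrite /P coef_sum (bigD1 1%g) //= coefCM w1 mul1r (sized 1%g).2.
  rewrite big1 => [|i _]; last by rewrite cf perm1 eqxx.
  rewrite big1 ?addr0 // => s s1; rewrite coefCM (sized s).2.
  have [i si] : exists i, i != s i.
    apply: contrapT => si; case/eqP: s1; apply/permP => i; rewrite perm1.
    by apply: contrapT => nsi; apply: si; exists i; apply/eqP => /esym.
  by rewrite (bigD1 i) //= cf (negPf si) mul0r mulr0.
have sizeP : size P = (n * d).+1.
  apply/eqP; rewrite eqn_leq; apply/andP; split; last first.
    rewrite ltnNge; apply/negP => le; move: P1; rewrite nth_default // => /esym/eqP.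
    by rewrite oner_eq0.
  apply/leq_sizeP => m le; rewrite /P coef_sum big1 // => s _.
  by rewrite coefCM nth_default ?mulr0 // (leq_trans (sized s).1).
by rewrite lead_coefE sizeP.
Qed.

Lemma permanent_monic n d (A : 'I_d.+1 -> 'M[S]_n) : A ord_max = 1%:M ->
  size (permanent (matpoly A)) = (n * d).+1 /\
  lead_coef (permanent (matpoly A)) = 1.
Proof.
move=> A1; have := size_coef_expansion _ _ A (fun=> 1) A1 erefl.
by rewrite /permanent; under eq_bigr do rewrite mul1r.
Qed.

End LeadingCoefficient.

Lemma lead_coef_det_matpoly (K : comNzRingType) n d (A : 'I_d.+1 -> 'M[K]_n) :
  A ord_max = 1%:M -> lead_coef (\det (matpoly A)) = 1.
Proof.
move=> A1; have [] := size_coef_expansion _ _ A (fun s => (-1) ^+ s) A1 _.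
  by rewrite odd_perm1.
move=> _; rewrite /determinant; congr (lead_coef _ = _); apply: eq_bigr => s _.
by rewrite rmorph_sign.
Qed.

(** * Factorization of min-plus polynomial functions *)

Section Factorization.
Context {R : realType}.
Implicit Types (x y z b : minplus R) (P : nat -> minplus R) (c : seq (minplus R)).

Lemma mp_leX2r m x y : (0 < m)%N -> x ^+ m <= y ^+ m -> x <= y.
Proof.
move=> m0; have [->|/mpfinP[r ->]] := eqVneq y 0; first by rewrite mp_le0.
have [->|/mpfinP[s ->]] := eqVneq x 0.
  by rewrite -(prednK m0) exprS mul0r mpfinX mp_leE leye_eq.
by rewrite !mpfinX !mpfin_le lerMn2r eqn0Ngt m0.
Qed.

(** In usual notation $s = (y - x)/m$, with $s = +\infty$ when $y = +\infty$. *)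
Lemma mp_div_root m x y : (0 < m)%N -> x != 0 -> exists s, x * s ^+ m = y.
Proof.
move=> m0 /mpfinP[r ->]; have [->|/mpfinP[s ->]] := eqVneq y 0.
  by exists 0; rewrite -(prednK m0) exprS mul0r mulr0.
exists (mpfin ((s - r) / m%:R)); rewrite mpfinX mpfinD; congr mpfin.
by rewrite -[X in r + X]mulr_natr divfK ?pnatr_eq0 -?lt0n // addrC subrK.
Qed.

Lemma mp_prod_addl y c : all (fun z => y <= z) c ->
  \prod_(z <- c) (y + z) = y ^+ size c.
Proof.
elim: c => [|z c IHc] /=; first by rewrite big_nil.
by case/andP=> yz yc; rewrite big_cons IHc // mp_addl // exprS.
Qed.

(* Take the steepest line through the leading coefficient that lies below all the
   coefficients, with slope [c0], touching [P k0] for some [k0 < N].  Below [c0]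
   only the leading term matters, above [c0] only the terms of degree at most [k0]
   do.  The lower bound on the roots is what makes the recursion go through. *)
Lemma mp_factor_bound N P : P N != 0 ->
  exists c, [/\ size c = N,
    forall b, (forall k, (k <= N)%N -> P N * b ^+ (N - k) <= P k) ->
      all (fun z => b <= z) c &
    forall y, \sum_(k < N.+1) P k * y ^+ k = P N * \prod_(z <- c) (y + z)].
Proof.
elim/ltn_ind: N => -[|N] IHN PN.
  by exists [::]; split=> // y; rewrite big_ord1 big_nil.
(* [s k] is a point where the terms of degree [k] and [N.+1] agree. *)
have /choice[s sE] (k : 'I_N.+1) := mp_div_root (N.+1 - k) _ (P k)
  (ltac:(by rewrite subn_gt0)) PN.
have [k0 _ s_min] := @arg_minP _ _ _ (ord0 : 'I_N.+1) predT s isT.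
set c0 := s k0 in s_min.
have c0_le k : (k <= N.+1)%N -> P N.+1 * c0 ^+ (N.+1 - k) <= P k.
  rewrite leq_eqVlt => /predU1P[->|kN]; first by rewrite subnn expr0 mulr1.
  by rewrite -(sE (Ordinal kN)) mp_leM // mp_leX // s_min.
have Pk0 : P k0 = P N.+1 * c0 ^+ (N.+1 - k0) by rewrite sE.
(* If [P k0] is $+\infty$, so are [c0] and all coefficients below the leading one, and every root is
   $+\infty$. *)
have [k0_oo|k0_fin] := eqVneq (P k0) 0.
  have c0_oo : c0 = 0.
    apply: le_anti; rewrite mp_le0 /=; apply: (@mp_leX2r (N.+1 - k0)).
      by rewrite subn_gt0.
    by rewrite -(mp_leM2l (P N.+1)) // -Pk0 k0_oo mp_le0.
  exists (nseq N.+1 0); split=> [|b _|y]; first by rewrite size_nseq.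
    by apply/allP => z; rewrite mem_nseq => /andP[_ /eqP->]; exact: mp_le0.
  rewrite mp_prod_addl ?size_nseq; last first.
    by apply/allP => z; rewrite mem_nseq => /andP[_ /eqP->]; exact: mp_le0.
  rewrite big_ord_recr big1 /= => [|k _]; first by rewrite add0r.
  suff -> : P k = 0 by rewrite mul0r.
  apply: le_anti; rewrite mp_le0 /= -[X in X <= _](mulr0 (P N.+1)).
  by have := c0_le k (ltnW (ltn_ord k)); rewrite c0_oo expr0n subn_eq0 leqNgt ltn_ord.
have [c [size_c bound_c c_prod]] := IHN k0 (ltn_ord k0) k0_fin.
(* The line bounding [P] passes through [P k0], so it also bounds the truncation of [P] at degree
   [k0], whose roots are therefore at least [c0]. *)
have c_ge : all (fun z => c0 <= z) c.
  apply: bound_c => k kk0.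
  rewrite Pk0 -mulrA -exprD addnBA // subnK ?c0_le //; last exact: ltnW.
  by rewrite (leq_trans kk0) // ltnW.
have size_cc : size (nseq (N.+1 - k0) c0 ++ c) = N.+1.
  by rewrite size_cat size_nseq size_c subnK // ltnW.
exists (nseq (N.+1 - k0) c0 ++ c); split=> // [b bP|y].
  have bc0 : b <= c0.
    apply: (@mp_leX2r (N.+1 - k0)); first by rewrite subn_gt0.
    by rewrite -(mp_leM2l (P N.+1)) // -Pk0 bP // ltnW.
  rewrite all_cat; apply/andP; split.
    by apply/allP => z; rewrite mem_nseq => /andP[_ /eqP->].
  by apply: sub_all c_ge => z; apply: le_trans.
(* Up to [c0] every factor equals [y], and the leading term attains the minimum. *)
have [y_le|/ltW y_ge] := leP y c0.
  rewrite mp_prod_addl ?size_cc; last first.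
    rewrite all_cat; apply/andP; split.
      by apply/allP => z; rewrite mem_nseq => /andP[_ /eqP->].
    by apply: sub_all c_ge => z; apply: le_trans.
  apply: le_anti; rewrite (mp_sum_le _ (@ord_max N.+1)) /=.
  apply: mp_le_sum => k _; have kN : (k <= N.+1)%N by rewrite -ltnS.
  rewrite -[in X in _ * X](subnK kN) exprD mulrA; apply: mp_leM => //.
  by apply: le_trans (c0_le k kN); rewrite mp_leM // mp_leX.
(* Beyond [c0] the copies of [c0] turn the leading coefficient into [P k0], which leaves the
   truncation of [P]. *)
rewrite big_cat /= mulrA.
have -> : \prod_(z <- nseq (N.+1 - k0) c0) (y + z) = c0 ^+ (N.+1 - k0).
  rewrite (eq_big_seq (fun=> c0)) => [|z]; last first.
    by rewrite mem_nseq => /andP[_ /eqP->]; rewrite mp_addr.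
  by rewrite big_const_seq count_predT size_nseq iter_mulr_1.
rewrite -Pk0 -c_prod; apply: le_anti; apply/andP; split.
  apply: mp_le_sum => k _.
  have k0N : (k0 < N.+2)%N by exact: leq_trans (ltn_ord k0) (leqnSn _).
  exact: (mp_sum_le (fun j : 'I_N.+2 => P j * y ^+ j) (widen_ord k0N k)).
apply: mp_le_sum => k _; have kN : (k <= N.+1)%N by rewrite -ltnS.
have [kk0|k0k] := ltnP k k0.+1.
  exact: (mp_sum_le (fun j : 'I_k0.+1 => P j * y ^+ j) (Ordinal kk0)).
(* A term of degree [k > k0] is at least the term of degree [k0]: bound [P k] by the line, then
   lower [k - k0] of the factors [y] to [c0]. *)
apply: le_trans (mp_sum_le _ ord_max) _ => /=.
apply: (@le_trans _ _ (P N.+1 * c0 ^+ (N.+1 - k) * y ^+ k)); last first.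
  by apply: mp_leM => //; exact: c0_le.
rewrite Pk0 -!mulrA; apply: mp_leM => //.
have -> : (N.+1 - k0 = N.+1 - k + (k - k0))%N by rewrite addnBA 1?ltnW // subnK.
rewrite exprD -mulrA; apply: mp_leM => //.
by rewrite -[in X in _ <= X](subnK (ltnW k0k)) exprD; apply: mp_leM => //; exact: mp_leX.
Qed.

End Factorization.

(** * Existence of the roots, and weak majorization from inequalities between products *)

Section Roots.
Context {R : realType}.
Implicit Types (x y z : minplus R) (s t : seq (minplus R)).

Lemma minplus_roots_exist (P : {poly minplus R}) : P != 0 ->
  exists c, minplus_roots P c.
Proof.
move=> P0; have [c [size_c _ c_prod]] := mp_factor_bound (size P).-1 (nth 0 P)
  (ltac:(by rewrite -lead_coefE lead_coef_eq0)).
exists (sort <=%O c); split; rewrite ?size_sort ?sort_sorted //.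
  exact: le_total.
move=> y; rewrite horner_coef (perm_big c) ?perm_sort //= lead_coefE -c_prod.
by rewrite prednK // lt0n size_poly_eq0.
Qed.

Lemma mp_prod_add_le r s : \prod_(z <- s) (r + z) <= \prod_(z <- s) z.
Proof. by apply: mp_le_prod => z _; exact: mp_add_ler. Qed.

Lemma mp_prod_add_leX r s : \prod_(z <- s) (r + z) <= r ^+ size s.
Proof.
elim: s => [|z s IHs]; first by rewrite big_nil.
by rewrite big_cons exprS mp_leM // mp_add_lel.
Qed.

(* For finite [y], cancelling the powers of [y] in the hypothesis at
   [y = nth s k] gives the claim; for [y = +oo] compare growth rates as the
   argument tends to infinity. *)
Lemma mp_prod_take_le s t : size s = size t -> sorted <=%O s ->
  (forall r, \prod_(z <- s) (mpfin r + z) <= \prod_(z <- t) (mpfin r + z)) ->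
  forall k, (k <= size s)%N -> \prod_(z <- take k s) z <= \prod_(z <- take k t) z.
Proof.
move=> size_st s_sorted st [|k] ks; first by rewrite !take0 !big_nil.
set y := nth 0 s k.
have s_split : s = take k s ++ y :: drop k.+1 s by rewrite -drop_nth // cat_take_drop.
have size_drop_s : size (y :: drop k.+1 s) = (size s - k)%N.
  by rewrite -drop_nth // size_drop.
have [y_ge y_le] : all (fun z => z <= y) (take k s) /\
    all (fun z => y <= z) (y :: drop k.+1 s).
  move: s_sorted; rewrite (sorted_pairwise le_trans) {1}s_split pairwise_cat.
  case/and3P=> /allrelP r1 _ /=; rewrite lexx => /andP[-> _]; split=> //.
  by apply/allP => z zs; apply: r1 => //; rewrite mem_head.
have size_k : (size s - k = (size s - k.+1).+1)%N by rewrite subnSK.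
have prod_s x : all (fun z => x <= z) (y :: drop k.+1 s) ->
  \prod_(z <- s) (x + z) = \prod_(z <- take k s) (x + z) * x ^+ (size s - k).
  by move=> xs; rewrite {1}s_split big_cat (mp_prod_addl _ _ xs) size_drop_s.
(* The first [k.+1] minima are bounded by the elements of [t], the remaining ones by [x]. *)
have prod_t x : \prod_(z <- t) (x + z) <=
    \prod_(z <- take k.+1 t) z * x ^+ (size s - k.+1).
  rewrite -{1}(cat_take_drop k.+1 t) big_cat size_st -size_drop mp_leM //.
    exact: mp_prod_add_le.
  exact: mp_prod_add_leX.
have [y0|] := eqVneq y 0; last first.
  case/mpfinP=> r yr; rewrite -(mp_leM2r (y ^+ (size s - k.+1))); last first.
    by rewrite yr mp_expf_neq0.
  apply: le_trans (prod_t y); rewrite yr; apply: le_trans (st r); rewrite -yr.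
  rewrite prod_s // (take_nth 0) // -/y big_rcons /= -mulrA -exprS -size_k.
  rewrite mp_leM // [X in _ <= X](eq_big_seq id) // => z /(allP y_ge) zy.
  exact: mp_addr.
suff -> : \prod_(z <- take k.+1 t) z = 0 by exact: mp_le0.
apply: contrapT => /eqP /mpfinP[b tb].
(* Elements of [take k s] may be $+\infty$; the minimum with the real number 0 keeps the product
   finite. *)
have /mpfinP[a sa] : \prod_(z <- take k s) (1 + z) != 0.
  rewrite mp_prod_eq0; apply/hasPn => z _; apply/eqP => z0.
  by have := mp_add_lel 1 z; rewrite z0 mp_leE leye_eq.
(* Since [r > b - a], the bound $a + (j+1) r \le b + j r$ reached below, with $j$ standing for
   [size s - k.+1], is absurd; [r] is nonnegative so that [1 + z] stays below [mpfin r + z]. *)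
pose r : R := `|b - a| + 1.
have r_ge : (1 : minplus R) <= mpfin r by rewrite mp_leE lee_fin addr_ge0.
have : mpfin a * mpfin r ^+ (size s - k) <= mpfin b * mpfin r ^+ (size s - k.+1).
  rewrite -sa -tb; apply: le_trans (prod_t _); apply: le_trans (st r).
  rewrite prod_s.
    rewrite mp_leM // mp_le_prod // => z _.
    by rewrite mp_le_add mp_add_ler (le_trans (mp_add_lel _ _)).
  by apply/allP => z /(allP y_le); rewrite y0; apply: le_trans; exact: mp_le0.
rewrite size_k exprS mulrA mp_leM2r ?mp_expf_neq0 // mpfinD mpfin_le leNgt.
by case/negP; rewrite /r -ltrBlDl (le_lt_trans (ler_norm _)) // ltrDl.
Qed.

(** Sorting changes neither product, and a min-plus product is a usual sum. *)
Lemma prod_le_weakly_majorized N (u v : N.-tuple (minplus R)) :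
  (forall r, \prod_(z <- v) (mpfin r + z) <= \prod_(z <- u) (mpfin r + z)) ->
  weakly_majorized u v.
Proof.
move=> uv k /andP[_ kN]; rewrite -!mpval_prod -mp_leE.
apply: mp_prod_take_le; rewrite ?size_sort ?size_tuple ?sort_sorted //.
  exact: le_total.
by move=> r; rewrite !(perm_big _ (permEl (perm_sort _ _))).
Qed.

End Roots.

(** * Upper and lower orders of magnitude at $0^+$ *)

Section Asymptotics.
Context {R : realType}.
Implicit Types (f g : R -> R[i]) (x y : minplus R) (e r s : R).

(** The default value is reached only at $+\infty$; it makes [mp_bigO f 0] say that [f] vanishes
    near 0. *)
Definition mppow e x : R := if (x : \bar R) is r%:E then e `^ r else 0.

Lemma mppow_ge0 e x : 0 <= mppow e x.
Proof. by rewrite /mppow; case: (x : \bar R) => // r; exact: powR_ge0. Qed.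

Lemma mppowM e x y : 0 < e -> mppow e (x * y) = mppow e x * mppow e y.
Proof.
move=> e0; have [->|/mpfinP[r ->]] := eqVneq x 0; first by rewrite mul0r mul0r.
have [->|/mpfinP[s ->]] := eqVneq y 0; first by rewrite mulr0 mulr0.
by rewrite mpfinD /mppow /= powRD // (lt0r_neq0 e0) implybT.
Qed.

Lemma mppow_le e x y : 0 < e <= 1 -> x <= y -> mppow e y <= mppow e x.
Proof.
move=> e01; have [->|/mpfinP[r ->]] := eqVneq y 0; first by rewrite mppow_ge0.
have [->|/mpfinP[s ->]] := eqVneq x 0; first by rewrite mp_leE leye_eq.
by rewrite mpfin_le; exact: (ger_powR e01).
Qed.

Definition mp_bigO f x := exists2 C : R, 0 <= C &
  \forall e \near 0^'+, `|f e| <= (C * mppow e x)%:C.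

Definition mp_bigOmega f x := exists2 c : R, 0 < c &
  \forall e \near 0^'+, (c * mppow e x)%:C <= `|f e|.

Lemma near_unit_interval : \forall e \near (0 : R)^'+, 0 < e <= 1.
Proof.
near=> e; apply/andP; split; first by near: e; exact: nbhs_right_gt.
by near: e; apply: nbhs_right_le.
Unshelve. all: by end_near. Qed.

Lemma mp_bigO_cst (c : R[i]) : mp_bigO (fun=> c) 1.
Proof.
(* The norm of a complex number lies in [R[i]]; its real part provides a constant in [R]. *)
have cR : (complex.Re `|c|)%:C = `|c| by rewrite RRe_real.
exists (complex.Re `|c|); first by rewrite -lecR cR normr_ge0.
by near=> e; rewrite /mppow /= powRr0 mulr1 cR.
Unshelve. all: by end_near. Qed.

Lemma mp_bigO0 : mp_bigO (fun=> 0) 0.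
Proof. by exists 0 => //; near=> e; rewrite normr0 mul0r lecR.
Unshelve. all: by end_near. Qed.

Lemma mp_bigO_add f g x y : mp_bigO f x -> mp_bigO g y ->
  mp_bigO (fun e => f e + g e) (x + y).
Proof.
move=> [C C0 fC] [D D0 gD]; exists (C + D); first exact: addr_ge0.
have e01 := near_unit_interval; near=> e.
have e1 : 0 < e <= 1 by near: e.
apply: le_trans (ler_normD _ _) _.
have fe : `|f e| <= (C * mppow e x)%:C by near: e.
have ge : `|g e| <= (D * mppow e y)%:C by near: e.
apply: le_trans (lerD fe ge) _; rewrite -rmorphD lecR mulrDl lerD // ler_wpM2l //.
  by rewrite mppow_le ?mp_add_lel.
by rewrite mppow_le ?mp_add_ler.
Unshelve. all: by end_near. Qed.

Lemma mp_bigO_mul f g x y : mp_bigO f x -> mp_bigO g y ->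
  mp_bigO (fun e => f e * g e) (x * y).
Proof.
move=> [C C0 fC] [D D0 gD]; exists (C * D); first exact: mulr_ge0.
near=> e.
have fe : `|f e| <= (C * mppow e x)%:C by near: e.
have ge : `|g e| <= (D * mppow e y)%:C by near: e.
rewrite normrM mppowM; last by near: e; exact: nbhs_right_gt.
by rewrite mulrACA rmorphM ler_pM.
Unshelve. all: by end_near. Qed.

Lemma mp_bigOmega_mul f g x y : mp_bigOmega f x -> mp_bigOmega g y ->
  mp_bigOmega (fun e => f e * g e) (x * y).
Proof.
move=> [C C0 fC] [D D0 gD]; exists (C * D); first exact: mulr_gt0.
near=> e.
have fe : (C * mppow e x)%:C <= `|f e| by near: e.
have ge : (D * mppow e y)%:C <= `|g e| by near: e.
rewrite normrM mppowM; last by near: e; exact: nbhs_right_gt.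
rewrite mulrACA rmorphM ler_pM // (lecR 0) mulr_ge0 ?mppow_ge0 // ltW //.
Unshelve. all: by end_near. Qed.

Lemma mp_bigO_sum (I : Type) (r : seq I) (F : I -> R -> R[i]) (X : I -> minplus R) :
  (forall i, mp_bigO (F i) (X i)) ->
  mp_bigO (fun e => \sum_(i <- r) F i e) (\sum_(i <- r) X i).
Proof.
move=> FX; elim: r => [|i r IHr].
  by rewrite big_nil; under eq_fun do rewrite big_nil; exact: mp_bigO0.
by rewrite big_cons; under eq_fun do rewrite big_cons; exact: mp_bigO_add.
Qed.

Lemma mp_bigO_prod (I : Type) (r : seq I) (F : I -> R -> R[i]) (X : I -> minplus R) :
  (forall i, mp_bigO (F i) (X i)) ->
  mp_bigO (fun e => \prod_(i <- r) F i e) (\prod_(i <- r) X i).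
Proof.
move=> FX; elim: r => [|i r IHr].
  by rewrite big_nil; under eq_fun do rewrite big_nil; exact: mp_bigO_cst.
by rewrite big_cons; under eq_fun do rewrite big_cons; exact: mp_bigO_mul.
Qed.

Lemma mp_bigOmega_prod (I : Type) (r : seq I) (F : I -> R -> R[i]) (X : I -> minplus R) :
  (forall i, mp_bigOmega (F i) (X i)) ->
  mp_bigOmega (fun e => \prod_(i <- r) F i e) (\prod_(i <- r) X i).
Proof.
move=> FX; elim: r => [|i r IHr].
  rewrite big_nil; under eq_fun do rewrite big_nil.
  by exists 1 => //; near=> e; rewrite /mppow /= powRr0 mulr1 normr1.
by rewrite big_cons; under eq_fun do rewrite big_cons; exact: mp_bigOmega_mul.
Unshelve. all: by end_near. Qed.

(** If $y < x$, the upper bound divided by $\epsilon^y$ tends to 0 and ends up below the positive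
    constant of the lower bound. *)
Lemma mp_bigO_bigOmega f x y : mp_bigO f x -> mp_bigOmega f y -> y != 0 -> x <= y.
Proof.
move=> [C C0 fC] [c c0 fc] /mpfinP[s ys]; rewrite {}ys in fc *.
rewrite leNgt; apply/negP => yx.
(* When [x] is $+\infty$ the function vanishes near 0, and any real exponent above [s] serves. *)
have {fC} [r sr fC] : exists2 r, s < r &
    \forall e \near 0^'+, `|f e| <= (C * (e `^ r))%:C.
  have [x0|/mpfinP[r xr]] := eqVneq x 0; last first.
    by exists r; rewrite -?mpfin_lt -?xr // xr in fC *.
  exists (s + 1); first by rewrite ltrDl.
  near=> e; apply: (@le_trans _ _ (C * mppow e x)%:C); first by near: e.
  by rewrite lecR ler_wpM2l // x0 /mppow /= powR_ge0.
have rs0 : 0 < r - s by rewrite subr_gt0.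
(* [C] may be 0, so the division is by [C + 1]. *)
have C1 : 0 < C + 1 by rewrite ltr_wpDl.
have small : \forall e \near (0 : R)^'+, e `^ (r - s) < c / (C + 1).
  have /cvgr_lt := powR_cvg0 rs0; apply; exact: divr_gt0.
have : \forall e \near (0 : R)^'+, False.
  near=> e.
  have e0 : 0 < e by near: e; exact: nbhs_right_gt.
  have le1 : (c * mppow e (mpfin s))%:C <= `|f e| by near: e.
  have le2 : `|f e| <= (C * (e `^ r))%:C by near: e.
  have := le_trans le1 le2; rewrite lecR /mppow /=.
  have -> : e `^ r = e `^ (r - s) * e `^ s.
    by rewrite -powRD ?subrK // (lt0r_neq0 e0) implybT.
  rewrite mulrA ler_pM2r ?powR_gt0 // leNgt => /negP; apply.
  apply: (@le_lt_trans _ _ ((C + 1) * e `^ (r - s))).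
    by rewrite ler_wpM2r ?powR_ge0 // lerDl.
  by rewrite mulrC -ltr_pdivlMr //; near: e.
by move/filter_ex => [].
Unshelve. all: by end_near. Qed.

End Asymptotics.

(** * Bounds derived from asymptotic equivalents *)

Section FirstOrder.
Context {R : realType}.
Implicit Types (f g : R -> R[i]) (x y : minplus R) (e r s : R).

Lemma simeq0 f (a : R[i]) : simeq f a 0 -> \forall e \near 0^'+, f e = 0.
Proof. by []. Qed.

(** Writing the limit as an indicator lets one computation cover the orders [r < s], [r = s] and
    [r > s] of two exponents. *)
Lemma powC_cvg r : 0 <= r ->
  (e `^ r)%:C @[e --> 0^'+] --> ((r == 0)%:R : (R[i])^o).
Proof.
rewrite le_eqVlt => /predU1P[<-|r0].
  by rewrite eqxx; under eq_fun do rewrite powRr0; exact: (@cvg_cst (R[i])^o).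
rewrite gt_eqF // mulr0n; apply/(@cvgr0Pnorm_lt _ (R[i])^o) => eps eps0.
have epsE : (complex.Re eps)%:C = eps by rewrite RRe_real // gtr0_real.
rewrite -epsE ltcR in eps0.
have small : \forall e \near (0 : R)^'+, e `^ r < complex.Re eps.
  by have /cvgr_lt := powR_cvg0 r0; apply.
near=> e; rewrite -epsE ger0_norm ?(lecR 0) ?powR_ge0 // ltcR.
by near: e.
Unshelve. all: by end_near. Qed.

Lemma norm_powC e r : `|(e `^ r)%:C : R[i]| = (e `^ r)%:C.
Proof. by rewrite ger0_norm // (lecR 0) powR_ge0. Qed.

Lemma powCN_K e r (c : R[i]) : 0 < e -> (e `^ r)%:C * ((e `^ (- r))%:C * c) = c.
Proof.
move=> e0; rewrite mulrA -rmorphM -powRD ?subrr ?powRr0 ?mul1r //.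
by rewrite (lt0r_neq0 e0) implybT.
Qed.

(** The rescaled function is eventually bounded by $|a| + 1$, also when $a = 0$; for the exponent
    $+\infty$ the constant 0 works. *)
Lemma simeq_bigO f (a : R[i]) x : simeq f a x -> mp_bigO f x.
Proof.
have [->|/mpfinP[r ->]] := eqVneq x 0.
  move/simeq0 => f0; exists 0 => //; near=> e.
  by rewrite mul0r (_ : f e = 0) ?normr0 //; near: e.
move=> fcv; have fa := @cvgr_norm_le _ (R[i])^o _ _ _ _ _ fcv.
have aR : (complex.Re `|a|)%:C = `|a| by rewrite RRe_real.
exists (complex.Re `|a| + 1).
  by rewrite addr_ge0 // -lecR aR normr_ge0.
near=> e; have e0 : 0 < e by near: e; exact: nbhs_right_gt.
rewrite -(powCN_K e r (f e)) // normrM norm_powC mulrC /mppow /= rmorphM.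
rewrite ler_wpM2r ?(lecR 0) ?powR_ge0 // rmorphD /= aR.
by near: e; apply: fa; rewrite ltrDl.
Unshelve. all: by end_near. Qed.

Lemma cvg_bigOmega f (l : R[i]) r : l != 0 ->
  (e `^ (- r))%:C * f e @[e --> 0^'+] --> (l : (R[i])^o) ->
  mp_bigOmega f (mpfin r).
Proof.
move=> l0 fcv; have fl := @cvgr_norm_ge _ (R[i])^o _ _ _ _ _ fcv.
have lR : (complex.Re `|l|)%:C = `|l| by rewrite RRe_real.
have lgt : 0 < complex.Re `|l| by rewrite -ltcR lR normr_gt0.
exists (complex.Re `|l| / 2); first exact: divr_gt0.
near=> e; have e0 : 0 < e by near: e; exact: nbhs_right_gt.
rewrite -(powCN_K e r (f e)) // normrM norm_powC [X in _ <= X]mulrC.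
rewrite /mppow /= rmorphM ler_wpM2r ?(lecR 0) ?powR_ge0 //.
by near: e; apply: fl; rewrite -lR ltcR ltr_pdivrMr // ltr_pMr // ltr1n.
Unshelve. all: by end_near. Qed.

(** After division by the smaller of the two powers the limit is $z$, $-a$ or $z - a$, never 0. If
    [x] is $+\infty$, [f] vanishes and the limit is $z$. *)
Lemma first_order_bigOmega f (a z : R[i]) x r : first_order f a x ->
  z != 0 -> z != a ->
  mp_bigOmega (fun e => z * (e `^ r)%:C - f e) (mpfin r + x).
Proof.
case=> _ fa xa z0 za.
have [x0|/mpfinP[s xs]] := eqVneq x 0.
  rewrite x0 addr0; apply: (@cvg_bigOmega _ z) => //.
  apply: (@cvg_near_cst _ (R[i])^o); rewrite x0 in fa; have f0 := simeq0 _ _ fa; near=> e.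
  rewrite (_ : f e = 0); last by near: e.
  rewrite subr0 mulrC -mulrA -rmorphM -powRD ?subrr ?powRr0 ?mulr1 //.
  by apply/implyP => _; rewrite gt_eqF //; near: e; exact: nbhs_right_gt.
have a0 : a != 0 by case: xa => [|/eqP//]; rewrite xs.
pose m := Num.min r s.
have mE : mpfin r + x = mpfin m by rewrite xs; apply: val_inj; rewrite /= -EFin_min.
rewrite mE; apply: (@cvg_bigOmega _ (z * (r - m == 0)%:R - (s - m == 0)%:R * a)).
  rewrite !subr_eq0 /m; case: (ltgtP r s) => rs.
  - by rewrite (gt_eqF rs) eqxx mul0r mulr1.
  - by rewrite (gt_eqF rs) eqxx mul1r mulr0 eq_sym.
  - by rewrite rs !eqxx mul1r mulr1.
have rm : 0 <= r - m by rewrite subr_ge0 /m ge_min lexx.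
have sm : 0 <= s - m by rewrite subr_ge0 /m ge_min lexx orbT.
have lim : z * (e `^ (r - m))%:C - (e `^ (s - m))%:C * ((e `^ (- s))%:C * f e)
    @[e --> 0^'+] --> (z * (r - m == 0)%:R - (s - m == 0)%:R * a : (R[i])^o).
  have lim1 := cvgM (cvg_cst (z : (R[i])^o)) (powC_cvg _ rm).
  have lim2 : (e `^ (- s))%:C * f e @[e --> 0^'+] --> (a : (R[i])^o) by rewrite xs in fa.
  have lim3 := cvgM (powC_cvg _ sm) lim2.
  exact: (cvgB (lim1 _ _) (lim3 _)).
apply: cvg_trans lim; apply: near_eq_cvg; near=> e.
have e0 : 0 < e by near: e; exact: nbhs_right_gt.
have powD u v : (e `^ u)%:C * (e `^ v)%:C = (e `^ (u + v))%:C :> R[i].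
  by rewrite -rmorphM -powRD // (lt0r_neq0 e0) implybT.
rewrite mulrBr; congr (_ - _); first by rewrite [RHS]mulrCA powD addrC.
by rewrite mulrA powD addrAC subrr add0r.
Unshelve. all: by end_near. Qed.

(** Determinant and permanent expand over the same permutations and entries, so the bounds on the
    entries combine term by term. *)
Lemma det_matpoly_bigO n d (cA : 'I_d.+1 -> R -> 'M[R[i]]_n)
    (A : 'I_d.+1 -> 'M[minplus R]_n) (z : R[i]) r :
  (forall k i j, mp_bigO (fun e => cA k e i j) (A k i j)) ->
  mp_bigO (fun e => (\det (matpoly (fun k => cA k e))).[z * (e `^ r)%:C])
          (permanent (matpoly A)).[mpfin r].
Proof.
move=> cAO.
have argO : mp_bigO (fun e => z * (e `^ r)%:C) (mpfin r).
  rewrite -[mpfin r]mul1r; apply: mp_bigO_mul; first exact: mp_bigO_cst.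
  by exists 1 => //; near=> e; rewrite mul1r norm_powC.
have argXO k : mp_bigO (fun e => (z * (e `^ r)%:C) ^+ k) (mpfin r ^+ k).
  elim: k => [|k IHk]; first exact: mp_bigO_cst.
  by rewrite exprS; under eq_fun do rewrite exprS; exact: mp_bigO_mul.
rewrite horner_permanent horner_matpoly /permanent.
under eq_fun do rewrite -horner_evalE -det_map_mx
  [map_mx _ _]horner_matpoly /determinant.
(* The inserted [1] is the exponent of the sign of the permutation, a bounded constant. *)
apply: mp_bigO_sum => s; rewrite -[X in mp_bigO _ X]mul1r.
apply: mp_bigO_mul; first exact: mp_bigO_cst.
apply: mp_bigO_prod => i.
rewrite summxE; under eq_fun do rewrite summxE.
apply: mp_bigO_sum => k; rewrite mxE; under eq_fun do rewrite mxE.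
exact: mp_bigO_mul.
Unshelve. all: by end_near. Qed.

End FirstOrder.

(** * Comparison of the two orders of the characteristic polynomial *)

Theorem theorem8p1 (R : realType) (n d : nat)
    (cA : 'I_d.+1 -> R -> 'M[R[i]]_n)
    (a : 'I_d.+1 -> 'M[R[i]]_n)
    (A : 'I_d.+1 -> 'M[minplus R]_n)
    (cA_germ : forall k i j, germC (fun e => cA k e i j))
    (cA_simeq : forall k i j, simeq (fun e => cA k e i j) (a k i j) (A k i j))
    (cA_monic : \forall e \near 0^'+, cA ord_max e = 1%:M)
    (A_monic : A ord_max = 1%:M) :
  (exists Gamma : (n * d).-tuple (minplus R), minplus_eigenvalues A Gamma) /\
  (forall Gamma : (n * d).-tuple (minplus R), minplus_eigenvalues A Gamma ->
   forall (L : 'I_(n * d) -> R -> R[i])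
     (lambda : 'I_(n * d) -> R[i])
     (Lambda : (n * d).-tuple (minplus R)),
   (\forall e \near 0^'+,
      roots_with_mult (\det (matpoly (fun k => cA k e)))
                      [seq L i e | i <- enum 'I_(n * d)]) ->
   (forall i, first_order (L i) (lambda i) (tnth Lambda i)) ->
   weakly_majorized Lambda Gamma).
Proof.
have [size_per lead_per] := permanent_monic _ _ A A_monic.
split.
  have per0 : permanent (matpoly A) != 0 by rewrite -size_poly_eq0 size_per.
  have [c cP] := minplus_roots_exist _ per0.
  have size_c : size c == (n * d)%N by case: cP => _ -> _ _; rewrite size_per.
  by exists (Tuple size_c).
move=> Gamma [_ _ _ GammaE] L lambda Lambda rootsL LP.
apply: prod_le_weakly_majorized => r.
(* The permanent is monic, so the product over [Gamma] is its value at [r]. *)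
have := GammaE (mpfin r); rewrite lead_per mul1r => <-.
(* This [z] is positive and exceeds every $|\lambda_i|$, hence it is nonzero and differs from each
   $\lambda_i$. *)
pose z := 1 + \sum_i `|lambda i|.
have z_gt i : `|lambda i| < z.
  rewrite /z (bigD1 i) //= addrCA ltrDl ltr_wpDr // sumr_ge0 //.
have z_ge0 : 0 < z by rewrite ltr_wpDr // sumr_ge0.
apply: (@mp_bigO_bigOmega _ (fun e => \prod_i (z * (e `^ r)%:C - L i e))).
(* Near 0 the determinant is monic, so its value at $z\epsilon^r$ is the product over the
   eigenvalues and the expansion bound applies to it. *)
- have [C C0 detO] := det_matpoly_bigO _ _ _ _ z r
    (fun k i j => simeq_bigO _ _ _ (cA_simeq k i j)).
  exists C => //; near=> e.
  have [_ detE] : roots_with_mult (\det (matpoly (fun k => cA k e)))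
                      [seq L i e | i <- enum 'I_(n * d)] by near: e.
  have := near detO e; rewrite detE.
  rewrite lead_coef_det_matpoly; last by near: e.
  rewrite scale1r big_map big_enum horner_prod.
  under eq_bigr do rewrite hornerXsubC.
  by apply.
- rewrite big_tuple.
  apply: mp_bigOmega_prod => i; apply: first_order_bigOmega (LP i) _ _.
    by rewrite gt_eqF.
  apply: contraTneq (z_gt i) => <-; rewrite ger0_norm ?ltxx //; exact: ltW.
(* Each minimum of the real number [r] with an element of [Lambda] is finite. *)
- rewrite mp_prod_eq0; apply/hasPn => x _; apply/eqP => x0.
  by have := mp_add_lel (mpfin r) x; rewrite x0 mp_leE leye_eq.
Unshelve. all: by end_near. Qed.
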